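(* There exists a universal constant $C>0$ such that the following holds. Let $n\ge2$, let $X_1,\dots,X_n$ be independent random vectors in $\mathbb{R}^p$, and let $\{\bm f_{ij}:\mathbb{R}^p\times\mathbb{R}^p\to\mathbb{R}^d\}_{1\le i<j\le n}$ be measurable symmetric functions that are completely degenerate, i.e. $\mathbb{E}\{\bm f_{ij}(X_i,X_j)\mid X_i\}=\bm 0$ and $\mathbb{E}\{\bm f_{ij}(X_i,X_j)\mid X_j\}=\bm 0$ almost surely for all $i<j$. Write $\bm f_{ij}=(f_{1,ij},\dots,f_{d,ij})$ and assume $$D_2:=\max_{1\le i<j\le n}\max_{1\le m\le d}\big(\mathbb{E}|f_{m,ij}(X_i,X_j)|^2\big)^{1/2}<\infty.$$ Let $\bm M_k=\sum_{1\le i<j\le k}\bm f_{ij}(X_i,X_j)$ for $2\le k\le n$. Then $$\mathbb{E}\left\{\max_{2\le k\le n}\frac{\|\bm M_k\|_2^2}{(k-1)^2}\right\}\le C\,D_2^2\,d\,\log n.$$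
   Context: $\|\cdot\|_2$ is the Euclidean norm on $\mathbb{R}^d$. *)

(* Defs.v *)
From HB Require Import structures.
From mathcomp Require Import all_boot all_order all_algebra.
From mathcomp Require Import all_classical all_reals all_analysis.

Set Implicit Arguments.
Unset Strict Implicit.
Unset Printing Implicit Defensive.

Import Order.TTheory GRing.Theory Num.Theory.
Import numFieldNormedType.Exports.

Local Open Scope classical_set_scope.
Local Open Scope ring_scope.

(* R^k is [k.-tuple R] with the product of the Borel sigma-algebras of R; this
   is the Borel sigma-algebra of R^k. *)

(* The norm that the library puts on vectors is the sup norm. *)
Definition enorm (R : realType) (k : nat) (v : k.-tuple R) : R :=
  Num.sqrt (\sum_(m < k) tnth v m ^+ 2).

Definition mutually_independent (dT dU : measure_display)
    (T : measurableType dT) (U : measurableType dU) (R : realType)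
    (P : probability T R) (I : finType) (X : I -> {RV P >-> U}) : Prop :=
  forall (J : {set I}) (A : I -> set U),
    (forall i, i \in J -> measurable (A i)) ->
    P (\bigcap_(i in [set` J]) (X i @^-1` A i)) =
    (\prod_(i in J) P (X i @^-1` A i))%E.
Arguments mutually_independent {dT dU T U R} P {I} X.

(* [Z] is a version of the conditional expectation E(Y | X) = E(Y | sigma(X)),
   where sigma(X) is the sigma-algebra of the sets X @^-1` B, B measurable. *)
Definition cond_expectation_version (dT dU : measure_display)
    (T : measurableType dT) (U : measurableType dU) (R : realType)
    (P : probability T R) (X : {RV P >-> U}) (Y Z : T -> R) : Prop :=
  [/\ P.-integrable [set: T] (EFin \o Y),
      P.-integrable [set: T] (EFin \o Z),
      measurable_fun [set: g_sigma_algebra_preimageType X]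
        (Z : g_sigma_algebra_preimageType X -> R) &
      forall A : set T, g_sigma_algebra_preimage X A ->
        (\int[P]_(w in A) (Y w)%:E = \int[P]_(w in A) (Z w)%:E)%E].
Arguments cond_expectation_version {dT dU T U R} P X Y Z.

(* E(Y | X) = Z0 almost surely. *)
Definition cond_expectation_ae_eq (dT dU : measure_display)
    (T : measurableType dT) (U : measurableType dU) (R : realType)
    (P : probability T R) (X : {RV P >-> U}) (Y Z0 : T -> R) : Prop :=
  exists2 Z : T -> R, cond_expectation_version P X Y Z &
    {ae P, forall w, Z w = Z0 w}.
Arguments cond_expectation_ae_eq {dT dU T U R} P X Y Z0.

Section degenerate_array.
Context (dT : measure_display) (T : measurableType dT) (R : realType)
  (P : probability T R) (n p d : nat).
(* Indices start at 0, and the arrays below are only used at i < j. *)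
Variables (X : 'I_n -> {RV P >-> p.-tuple R})
  (f : 'I_n -> 'I_n -> p.-tuple R * p.-tuple R -> d.-tuple R).

Definition fX (i j : 'I_n) (w : T) : d.-tuple R := f i j (X i w, X j w).

Definition completely_degenerate : Prop :=
  forall (i j : 'I_n) (m : 'I_d), (i < j)%N ->
    cond_expectation_ae_eq P (X i) (fun w => tnth (fX i j w) m) (cst 0) /\
    cond_expectation_ae_eq P (X j) (fun w => tnth (fX i j w) m) (cst 0).

(* The maximum of nonnegative extended reals; hence the neutral element 0. *)
Definition D2 : \bar R :=
  (\big[maxe/0]_(i < n) \big[maxe/0]_(j < n | (i < j)%N) \big[maxe/0]_(m < d)
     'E_P[fun w => (`|tnth (fX i j w) m| ^+ 2)%R] `^ 2^-1)%E.

(* The sum over the pairs among the first k vectors. *)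
Definition M (k : nat) (w : T) : d.-tuple R :=
  [tuple \sum_(i < n) \sum_(j < n | (i < j < k)%N) tnth (fX i j w) m | m < d].

End degenerate_array.

Arguments fX {dT T R} P {n p d} X f i j w.
Arguments completely_degenerate {dT T R} P {n p d} X f.
Arguments D2 {dT T R} P {n p d} X f.
Arguments M {dT T R} P {n p d} X f k w.

(* Main.v *)
Require Import Defs.
From HB Require Import structures.
From mathcomp Require Import all_boot all_order all_algebra.
From mathcomp Require Import all_classical all_reals all_analysis.
From mathcomp Require Import measurable_realfun ring lra.

(** Fix a coordinate [m], let [u_ij] be the coordinate [m] of [f_ij (X_i, X_j)]
    and let [r_j] be the sum of the [u_ij] over [i < j], a row with [j] terms
    since indices start at 0.  A square integrable variable that depends on one
    of [X_i], [X_j] but not on the other is orthogonal to [u_ij]: integrate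
    first over the variable that it does not see, and use degeneracy
    ([ip_degenerate]).  Hence the [u_ij] of a row are orthogonal, so that
    [E r_j^2 <= j D2^2], and the rows are martingale differences.

    Rather than cutting the range of [k] into dyadic blocks and treating [M_k]
    on each of them, the proof puts the weights into the martingale: let
    [Y_k] be the sum of the [r_j / j] over [j < k].  Summation by parts
    expresses [M_(k+1)] as [k Y_(k+1)] minus the sum of [Y_1], ..., [Y_k], so
    [|M_(k+1)| / k] is at most twice the maximum of the [|Y_j|]
    ([normalized_sum_le_runmax]).  One application of Doob's inequality in [L2]
    to [Y] and one to [- Y] ([doob_sqr_le]) reduce the claim to [E Y_n^2], which
    by orthogonality is the sum of the [E r_j^2 / j^2], at most [D2^2] times a
    harmonic sum, that is at most [2 D2^2 ln n].

    The Euclidean norm only enters at the end: the maximum over [k] of a sum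
    over coordinates is at most the sum of the maxima, which gives the factor
    [d] and the constant 64: 4 from the summation by parts, 4 from Doob's
    inequality, 2 for the two signs and 2 from the harmonic sum. *)

Set Implicit Arguments.
Unset Strict Implicit.
Unset Printing Implicit Defensive.

Import Order.TTheory GRing.Theory Num.Theory.
Import numFieldNormedType.Exports.

Local Open Scope classical_set_scope.
Local Open Scope ring_scope.

(** * Independent pairs and degenerate kernels *)

Section independent_pair.
Context (dT dU dS : measure_display) (T : measurableType dT)
  (U : measurableType dU) (S : measurableType dS) (R : realType)
  (P : probability T R).
Variables (X : {RV P >-> U}) (Z : {RV P >-> S}).
Local Open Scope ereal_scope.

Definition independent_pair := forall A B, measurable A -> measurable B ->
  P (X @^-1` A `&` Z @^-1` B) = P (X @^-1` A) * P (Z @^-1` B).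

(** Both sides are finite measures of [A], so they agree as soon as they agree
    on a generating class closed under intersection. *)
Lemma independent_pair_generator (G : set (set U)) :
  measurable = <<s G >> -> setI_closed G -> G setT ->
  (forall A B, G A -> measurable B ->
     P (X @^-1` A `&` Z @^-1` B) = P (X @^-1` A) * P (Z @^-1` B)) ->
  independent_pair.
Proof.
move=> mG IG GT indG A B mA mB.
have mZB : measurable (Z @^-1` B).
  by rewrite -[_ @^-1` _]setTI; exact: measurable_funPT.
have c0 : (0 <= fine (P (Z @^-1` B)))%R by rewrite fine_ge0.
pose m1 := pushforward (mrestr P mZB) X.
pose m2 := mscale (NngNum c0) (distribution P X).
have m2E C : m2 C = P (X @^-1` C) * P (Z @^-1` B).
  by rewrite muleC -[P (Z @^-1` B)]fineK// fin_num_measure.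
rewrite -m2E -[LHS]/(m1 A).
apply: (@measure_unique _ _ _ G (fun=> setT)) => //.
- by apply/seteqP; split => // x _; exists 0%N.
- by move=> C GC; rewrite [RHS]m2E -indG.
- move=> _; rewrite (@le_lt_trans _ _ 1%:E) ?ltry//.
  apply: (@probability_le1 _ _ _ P (X @^-1` setT `&` Z @^-1` B)).
  by rewrite preimage_setT setTI.
Qed.

Hypothesis XZ : independent_pair.

Let W w := (X w, Z w).

Let mW : measurable_fun [set: T] W.
Proof. exact: measurable_fun_pair. Qed.

(** The joint law of an independent pair is the product law; this is what makes
    Fubini's theorem available for functions of the pair. *)
Lemma independent_pair_law C : measurable C ->
  P (W @^-1` C) = (distribution P X \x distribution P Z) C.
Proof.
move=> mC; apply/esym.
by rewrite (@product_measure_unique _ _ _ _ _ _ _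
  (distribution P (mfun_Sub (mem_set mW)))).
Qed.

Section fubini.
Variable k : U * S -> \bar R.
Hypotheses (mk : measurable_fun setT k)
  (ik : P.-integrable [set: T] (k \o W)).

Lemma independent_pair_integrable :
  (distribution P X \x distribution P Z).-integrable setT k.
Proof.
have := integrable_pushforward mW mk ik measurableT.
move/integrableP => [_ koo]; apply/integrableP; split => //.
rewrite (eq_measure_integral (pushforward P W))// => C mC _.
exact/esym/independent_pair_law.
Qed.

Lemma independent_pair_integral :
  \int[P]_w k (W w) =
  \int[distribution P X]_x \int[distribution P Z]_z k (x, z).
Proof.
rewrite -[RHS]/(\int[distribution P X]_x fubini_F (distribution P Z) k x).
rewrite integral12_prod_meas1//; last exact: independent_pair_integrable.
rewrite -[LHS]/(\int[P]_(w in W @^-1` setT) (k \o W) w).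
rewrite -(integral_pushforward mW mk)//.
by apply: eq_measure_integral => // C mC _; exact: independent_pair_law.
Qed.

End fubini.
End independent_pair.

Section degenerate_orthogonality.
Context (dT dU dS dV : measure_display) (T : measurableType dT)
  (U : measurableType dU) (S : measurableType dS) (V : measurableType dV)
  (R : realType) (P : probability T R).
Variables (Z : {RV P >-> S}) (X : {RV P >-> U}) (v : S -> V)
  (g : V * U -> R) (h : S -> R).
Hypotheses (ZX : independent_pair Z X) (mv : measurable_fun [set: S] v)
  (mg : measurable_fun setT g) (mh : measurable_fun setT h).
Local Open Scope ereal_scope.
Hypotheses
  (ig : P.-integrable setT (fun w => (g (v (Z w), X w))%:E))
  (ihg : P.-integrable setT (fun w => (h (Z w) * g (v (Z w), X w))%:E))
  (g0 : forall B, measurable B ->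
    \int[P]_(w in (v \o Z) @^-1` B) (g (v (Z w), X w))%:E = 0).

Let Y : {RV P >-> V} :=
  mfun_Sub (mem_set (measurableT_comp mv (@measurable_funPT _ _ _ _ Z))).

Let YX : independent_pair Y X.
Proof.
move=> A B mA mB; apply: (ZX (A := v @^-1` A)) => //.
by rewrite -[_ @^-1` _]setTI; exact: mv.
Qed.

Let phi y := \int[distribution P X]_x (g (y, x))%:E.

Let eg : measurable_fun setT (EFin \o g).
Proof. exact/measurable_EFinP. Qed.

(** By Fubini's theorem for the pair [(v Z, X)], the conditional expectation of
    [g (v Z, X)] given [v Z] is [phi (v Z)]; its integral over every event of
    [v Z] vanishes by [g0]. *)
Let phi0 : ae_eq (distribution P Y) setT phi (cst 0).
Proof.
have igYX := independent_pair_integrable YX eg ig.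
have iphi : (distribution P Y).-integrable setT phi := integrable_fubini_F igYX.
apply: integral_ae_eq => // B _ mB.
rewrite integral_cst// mul0e -(g0 mB).
have mYB : measurable (Y @^-1` B).
  by rewrite -[_ @^-1` _]setTI; exact: measurable_funPT.
pose k (yx : V * U) := (\1_B yx.1 * g yx)%:E.
have mk : measurable_fun setT k.
  apply/measurable_EFinP; apply: measurable_funM => //.
  by apply: measurableT_comp => //; exact: measurable_indic.
have kE : k \o (fun w => (Y w, X w)) =
    (fun w => (g (v (Z w), X w))%:E) \_ (Y @^-1` B).
  apply/funext => w; rewrite /k /= patchE indicE.
  rewrite -[w \in _]/(v (Z w) \in B).
  by case: ifP => _; rewrite ?mul1r ?mul0r.
have ik : P.-integrable setT (k \o (fun w => (Y w, X w))).
  rewrite kE; apply/(integrable_mkcond _ mYB).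
  exact: (integrableS measurableT mYB (@subsetT _ _) ig).
rewrite [RHS]integral_mkcond -kE (independent_pair_integral YX mk)//.
rewrite integral_mkcond; apply: eq_integral => y _; rewrite patchE /k /phi/=.
rewrite indicE; case: (y \in B).
  by apply: eq_integral => x _; rewrite mul1r.
by rewrite integral0_eq// => x _; rewrite mul0r.
Qed.

(** For almost every value [z] of [Z], the integral over [X] of
    [h z * g (v z, X)] is [h z * phi (v z) = 0].  The factor [h z] may only be
    taken out of the integral where [g (v z, X)] is integrable, hence the two
    almost sure conditions in the proof. *)
Lemma integral_degenerate : \int[P]_w (h (Z w) * g (v (Z w), X w))%:E = 0.
Proof.
pose k (zx : S * U) := (h zx.1 * g (v zx.1, zx.2))%:E.
have mk : measurable_fun setT k.
  apply/measurable_EFinP; apply: measurable_funM.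
    exact: measurableT_comp.
  apply: measurableT_comp => //; apply: measurable_fun_pair => //.
  exact: measurableT_comp.
rewrite (independent_pair_integral ZX mk)//=.
have ig1 := ae_integrable1 (independent_pair_integrable YX eg ig).
have ae : {ae distribution P Z, forall z,
    \int[distribution P X]_x k (z, x) = 0}.
  have [N [mN PN NE]] : {ae distribution P Y, forall y,
      (distribution P X).-integrable setT (fun x => (g (y, x))%:E) /\
      phi y = 0}.
    by apply: filterS2 phi0 ig1 => y /(_ I) ? ?.
  exists (v @^-1` N); split.
  - by rewrite -[_ @^-1` _]setTI; exact: mv.
  - exact: PN.
  - move=> z /= kz; apply: NE => /= -[gv phiv]; apply: kz.
    rewrite -[LHS]/(\int[distribution P X]_x ((h z)%:E * (g (v z, x))%:E)).
    by rewrite integralZl// -/(phi _) phiv mule0.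
have mF := integrable_fubini_F (independent_pair_integrable ZX mk ihg).
rewrite (ae_eq_integral (cst 0))//; first by rewrite integral0.
  exact: measurable_int mF.
by apply: filterS ae => z ? _.
Qed.
End degenerate_orthogonality.

(** * Running maxima of real sequences *)

Section running_maximum.
Context (R : realType).
Implicit Types (y a : nat -> R).

Fixpoint runmax y k : R :=
  if k is k'.+1 then Num.max (runmax y k') (y k) else 0.

Lemma runmax_ge0 y k : 0 <= runmax y k.
Proof. by elim: k => //= k IH; rewrite le_max IH. Qed.

Lemma le_runmax y k j : y 0%N = 0 -> (j <= k)%N -> y j <= runmax y k.
Proof.
move=> y0; elim: k => [|k IH]; first by rewrite leqn0 => /eqP ->; rewrite y0.
by rewrite leq_eqVlt => /predU1P[->|/IH jk]/=; rewrite le_max ?lexx ?orbT// jk.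
Qed.

(** The pathwise step of Doob's inequality: if the maximum moves, it moves up to
    [y k.+1].  For a random [y], every term is a product of two square
    integrable variables, which can be integrated separately. *)
Lemma runmaxS_sqr_le y k :
  runmax y k.+1 * runmax y k.+1 + 2 * y k.+1 * runmax y k <=
  runmax y k * runmax y k + 2 * y k.+1 * runmax y k.+1.
Proof.
rewrite /=; have p0 := runmax_ge0 y k; set p := runmax y k in p0 *.
by rewrite /Num.max; case: ltP => pk; nra.
Qed.

(** Kronecker's argument: the partial sums of [a] are recovered from the
    weighted partial sums [y] by summation by parts.  The running maxima of [y]
    and of [- y] together control the absolute values of [y]. *)
Lemma normalized_sum_le_runmax a N k :
  let y k := \sum_(j < k) j%:R^-1 * a j in
  a 0%N = 0 -> (k < N)%N ->
  (\sum_(j < k.+1) a j) ^+ 2 / k%:R ^+ 2 <=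
    4 * (runmax y N ^+ 2 + runmax (fun j => - y j) N ^+ 2).
Proof.
move=> y a0 kN.
set p := runmax y N; set q := runmax _ N.
have y0 : y 0%N = 0 by rewrite /y big_ord0.
have [p0 q0] : 0 <= p /\ 0 <= q by split; exact: runmax_ge0.
pose s := Num.max p q.
have ys j : (j <= N)%N -> `|y j| <= s.
  move=> jN; rewrite ler_norml /s; apply/andP; split.
    by rewrite lerNl le_max (le_runmax (y := fun j => - y j)) ?y0 ?oppr0// orbT.
  by rewrite le_max le_runmax.
have -> : \sum_(j < k.+1) a j = k%:R * y k.+1 - \sum_(j < k.+1) y j.
  elim: k {kN} => [|k IH].
    by rewrite !big_ord_recr !big_ord0/= y0 a0; ring.
  rewrite big_ord_recr/= IH [in RHS]big_ord_recr/=.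
  have -> : y k.+2 = y k.+1 + k.+1%:R^-1 * a k.+1 by rewrite /y big_ord_recr.
  rewrite mulrDr mulrA divff ?pnatr_eq0// mul1r -natr1; ring.
have [->|k0] := posnP k; first by rewrite expr0n/= invr0 mulr0; nra.
rewrite ler_pdivrMr ?exprn_gt0 ?ltr0n//.
have sy : `|\sum_(j < k.+1) y j| <= k%:R * s.
  rewrite big_ord_recl/= y0 add0r (le_trans (ler_norm_sum _ _ _))//.
  apply: (@le_trans _ _ (\sum_(i < k) s)).
    by apply: ler_sum => i _; apply: ys; exact: leq_trans (ltn_ord i) (ltnW kN).
  by rewrite sumr_const card_ord mulr_natl.
have sk : `|k%:R * y k.+1 - \sum_(j < k.+1) y j| <= 2 * k%:R * s.
  rewrite (le_trans (ler_normB _ _))// normrM normr_nat.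
  rewrite (_ : 2 * k%:R * s = k%:R * s + k%:R * s); last ring.
  by rewrite lerD// ler_wpM2l// ys.
rewrite -[X in X <= _]real_normK ?num_real//.
have s0 : 0 <= s by rewrite /s le_max p0.
apply: (@le_trans _ _ ((2 * k%:R * s) ^+ 2)).
  by rewrite ler_sqr ?nnegrE// !mulr_ge0.
have : s ^+ 2 <= p ^+ 2 + q ^+ 2.
  by rewrite /s /Num.max; case: ifP => _; rewrite ?lerDl ?lerDr sqr_ge0.
move=> spq; rewrite (_ : _ ^+ 2 = 4 * s ^+ 2 * k%:R ^+ 2); last ring.
by rewrite ler_wpM2r ?sqr_ge0// ler_wpM2l.
Qed.

End running_maximum.

Lemma measurable_runmax d (T : measurableType d) (R : realType)
    (Y : nat -> T -> R) k :
  (forall j, (j <= k)%N -> measurable_fun setT (Y j)) ->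
  measurable_fun setT (fun w => runmax (Y ^~ w) k).
Proof.
elim: k => [|k IH] mY /=; first exact: measurable_cst.
by apply: measurable_maxr; [apply: IH => j jk; apply/mY/leqW|exact: mY].
Qed.

Lemma measurable_sum_cond d (T : measurableType d) (R : realType) (I : Type)
    (s : seq I) (Q : pred I) (F : I -> T -> R) :
  (forall i, Q i -> measurable_fun setT (F i)) ->
  measurable_fun setT (fun w => \sum_(i <- s | Q i) F i w).
Proof.
move=> mF.
rewrite (_ : (fun _ => _) = fun w => \sum_(i <- s) if Q i then F i w else 0).
  apply: measurable_sum => i.
  have := mF i.
  case: (Q i) => [/(_ isT)//|_].
  exact: measurable_cst.
by apply/funext => w; rewrite big_mkcond.
Qed.

(** The term with [j = 0] is [0^-1 = 0].  The bound is purely multiplicative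
    because the final estimate has no additive constant; its factor comes from
    [n.+2 <= 2 * n.+1]. *)
Lemma harmonic_le_ln (R : realType) n :
  \sum_(j < n.+1) (j%:R^-1 : R) <= 2 * ln n.+1%:R.
Proof.
elim: n => [|n IH].
  by rewrite big_ord_recr big_ord0/= invr0 add0r ln1 mulr0.
rewrite big_ord_recr/= (le_trans (lerD IH (lexx _)))//.
suff : n.+1%:R^-1 <= 2 * (ln n.+2%:R - ln n.+1%:R) :> R.
  by rewrite mulrBr lerBrDl.
rewrite -ln_div ?posrE ?ltr0n//.
(* [ln (1 + x) <= x] at [x = - n.+2^-1] only yields [n.+2^-1]. *)
have h : 2^-1 * n.+1%:R^-1 <= n.+2%:R^-1 :> R.
  rewrite mulrC -invfM lef_pV2 ?posrE ?mulr_gt0 ?ltr0n//.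
  by rewrite -natrM ler_nat muln2 -addnn addSn addnS !ltnS leq_addl.
have : n.+2%:R^-1 <= - ln (n.+1%:R / n.+2%:R) :> R.
  have -> : n.+1%:R / n.+2%:R = 1 + - n.+2%:R^-1 :> R.
    rewrite -[in LHS]natr1 -[in RHS](@divff _ n.+2%:R) ?pnatr_eq0//; field.
    by rewrite ?pnatr_eq0// ?natr1 ?pnatr_eq0.
  rewrite lerNr; apply: le_ln1Dx.
  by rewrite ltrN2 invf_lt1 ?ltr1n// ltr0n.
have -> : ln (n.+2%:R / n.+1%:R) = - ln (n.+1%:R / n.+2%:R) :> R.
  by rewrite -lnV ?posrE ?divr_gt0 ?ltr0n// invf_div.
move/(le_trans h); rewrite -ler_pdivrMl ?ltr0n//.
Qed.

(** * Square integrable variables and Doob's inequality *)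

Section square_integrable.
Context d (T : measurableType d) (R : realType) (P : probability T R).
Implicit Types f g h : T -> R.
Local Notation L2 := (Lfun P 2%:E).

Lemma L2_measurable f : f \in L2 -> measurable_fun setT f.
Proof. by rewrite inE => /andP[/[!inE]/= ]. Qed.

Lemma L2D f g : f \in L2 -> g \in L2 -> (fun w => f w + g w) \in L2.
Proof. by move=> fL gL; apply: ((Lfun_addr_closed P (lee1n 2)).2 f g). Qed.

Lemma L2Z c f : f \in L2 -> (fun w => c * f w) \in L2.
Proof.
move=> fL; have [zL /(_ c f (cst 0) fL zL)] := Lfun_submod_closed P (lee1n 2).
suff -> : (fun w => c * f w) = c *: f + cst 0 by [].
by apply/funext => w; rewrite -[LHS]addr0.
Qed.

Lemma L2_cst0 : (fun=> 0) \in L2.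
Proof. by have [] := Lfun_addr_closed P (lee1n 2). Qed.

Lemma L2_sum (I : Type) (s : seq I) (Q : pred I) (F : I -> T -> R) :
  (forall i, Q i -> F i \in L2) -> (fun w => \sum_(i <- s | Q i) F i w) \in L2.
Proof.
move=> FL; elim: s => [|i s IH].
  rewrite (_ : (fun _ => _) = (fun=> 0)) ?L2_cst0//.
  by apply/funext => w; rewrite big_nil.
rewrite (_ : (fun _ => _) =
  if Q i then fun w => F i w + \sum_(j <- s | Q j) F j w
  else fun w => \sum_(j <- s | Q j) F j w); last first.
  by apply/funext => w; rewrite big_cons; case: ifP.
by case: ifP => // Qi; apply: L2D => //; exact: FL.
Qed.

Lemma L2_norm f : f \in L2 -> (fun w => `|f w|) \in L2.
Proof.
case/andP; rewrite !inE/= => mf finf; apply/andP; split.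
  by rewrite inE/=; exact: measurableT_comp.
rewrite inE/= /finite_norm.
under [X in ('N[_]__[X])%E]eq_fun => x do rewrite /= -abse_EFin.
by rewrite Lnorm_abse.
Qed.

(** The maximum is a linear combination of the sum and of the absolute value of
    the difference. *)
Lemma L2_max f g : f \in L2 -> g \in L2 ->
  (fun w => Num.max (f w) (g w)) \in L2.
Proof.
move=> fL gL.
have -> : (fun w => Num.max (f w) (g w)) =
    (fun w => 2^-1 * ((f w + g w) + `|f w + -1 * g w|)).
  apply/funext => w; rewrite mulN1r /Num.max; case: ltP => fg.
    rewrite ler0_norm; last by rewrite subr_le0 ltW.
    lra.
  rewrite ger0_norm ?subr_ge0//; lra.
by apply/L2Z/L2D; [exact: L2D|apply/L2_norm/L2D => //; exact: L2Z].
Qed.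

Lemma L2_runmax (Y : nat -> T -> R) k : (forall j, (j <= k)%N -> Y j \in L2) ->
  (fun w => runmax (Y ^~ w) k) \in L2.
Proof.
elim: k => [|k IH] YL /=; first exact: L2_cst0.
by apply: L2_max; [apply: IH => j jk; apply/YL/leqW|exact: YL].
Qed.

(** The inner product of [L2]; it is only meaningful on [Lfun P 2]. *)
Definition ip f g := \int[P]_w (f w * g w).

Lemma ip_integrable f g : f \in L2 -> g \in L2 ->
  P.-integrable setT (EFin \o (fun w => f w * g w)).
Proof. by move=> fL gL; apply/Lfun1_integrable/Lfun2_mul_Lfun1. Qed.

Lemma ipC f g : ip f g = ip g f.
Proof. by apply: eq_Rintegral => w _; rewrite mulrC. Qed.

Lemma ip0r f : ip f (fun=> 0) = 0.
Proof.
rewrite /ip; under eq_Rintegral do rewrite mulr0.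
by rewrite Rintegral_cst// mul0r.
Qed.

Lemma ipDl f g h : f \in L2 -> g \in L2 -> h \in L2 ->
  ip (fun w => f w + g w) h = ip f h + ip g h.
Proof.
move=> fL gL hL; rewrite /ip -RintegralD//; try exact: ip_integrable.
by apply: eq_Rintegral => w _; rewrite mulrDl.
Qed.

Lemma ipZl c f g : f \in L2 -> g \in L2 -> ip (fun w => c * f w) g = c * ip f g.
Proof.
move=> fL gL; rewrite /ip -RintegralZl//; last exact: ip_integrable.
by apply: eq_Rintegral => w _; rewrite mulrA.
Qed.

Lemma ip_suml (I : Type) (s : seq I) (Q : pred I) (F : I -> T -> R) g :
  (forall i, Q i -> F i \in L2) -> g \in L2 ->
  ip (fun w => \sum_(i <- s | Q i) F i w) g = \sum_(i <- s | Q i) ip (F i) g.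
Proof.
move=> FL gL; elim: s => [|i s IH].
  rewrite big_nil (_ : (fun _ => _) = (fun=> 0)) ?[ip _ g]ipC ?ip0r//.
  by apply/funext => w; rewrite big_nil.
rewrite big_cons -IH; case: ifPn => Qi.
  rewrite -ipDl//; [|exact: FL|exact: L2_sum].
  by apply: eq_Rintegral => w _; rewrite big_cons Qi.
by apply: eq_Rintegral => w _; rewrite big_cons (negbTE Qi).
Qed.

Section martingale.
Variables (D : nat -> T -> R) (N : nat).
Let Y k w := \sum_(j < k) D j w.
Let p k w := runmax (Y ^~ w) k.
Hypothesis DL : forall k, D k \in L2.

Lemma L2_partial_sum k : Y k \in L2.
Proof. exact: L2_sum. Qed.

Lemma partial_sum_sqr : (forall k, (k < N)%N -> ip (Y k) (D k) = 0) ->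
  ip (Y N) (Y N) = \sum_(k < N) ip (D k) (D k).
Proof.
elim: N => [|n IH] YD.
  rewrite big_ord0 (_ : Y 0 = (fun=> 0)) ?ip0r//.
  by apply/funext => w; rewrite /Y big_ord0.
rewrite big_ord_recr/= -IH; last by move=> k /leqW; exact: YD.
have YS : Y n.+1 = (fun w => Y n w + D n w).
  by apply/funext => w; rewrite /Y big_ord_recr.
have YL := L2_partial_sum.
rewrite [LHS](_ : _ = ip (fun w => Y n w + D n w) (Y n.+1)); last first.
  by rewrite -YS.
rewrite ipDl// ![ip _ (Y n.+1)]ipC YS !ipDl// (ipC (D n)) YD//.
by rewrite addr0 add0r.
Qed.

(** Doob's maximal inequality in [L2].  Summing the pathwise steps, in which the
    increments are orthogonal to the past maxima, gives
    [E p^2 <= 2 E (Y p)]; completing the square, [0 <= E (2 Y - p)^2], turns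
    this into the claim.  The hypothesis is what the martingale property yields
    for the running maximum, a function of the past increments. *)
Lemma doob_sqr_le : (forall k, (k < N)%N -> ip (p k) (D k) = 0) ->
  ip (p N) (p N) <= 4 * ip (Y N) (Y N).
Proof.
move=> pD.
have YL := L2_partial_sum.
have pL k : p k \in L2 by apply: L2_runmax.
have pY : ip (p N) (p N) <= 2 * ip (Y N) (p N).
  elim: N pD => [|n IH] pD.
    have -> : p 0 = (fun=> 0) by [].
    by rewrite !ip0r mulr0.
  have {}IH := IH (fun k kn => pD k (leqW kn)).
  have Y2L : (fun w => 2 * Y n.+1 w) \in L2 by exact: L2Z.
  have step : ip (p n.+1) (p n.+1) + ip (fun w => 2 * Y n.+1 w) (p n) <=
      ip (p n) (p n) + ip (fun w => 2 * Y n.+1 w) (p n.+1).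
    rewrite /ip -RintegralD; [|exact: measurableT|exact: ip_integrable..].
    rewrite -RintegralD; [|exact: measurableT|exact: ip_integrable..].
    apply: le_Rintegral; [exact: measurableT|..|].
    - exact: (integrableD measurableT (ip_integrable (pL _) (pL _))
        (ip_integrable Y2L (pL _))).
    - exact: (integrableD measurableT (ip_integrable (pL _) (pL _))
        (ip_integrable Y2L (pL _))).
    - by move=> w _; exact: runmaxS_sqr_le.
  have YpE : ip (Y n.+1) (p n) = ip (Y n) (p n).
    have -> : Y n.+1 = (fun w => Y n w + D n w).
      by apply/funext => w; rewrite /Y big_ord_recr.
    by rewrite ipDl// [ip (D n) _]ipC pD// addr0.
  by move: step; rewrite !ipZl// YpE; lra.
pose e w := 2 * Y N w + -1 * p N w.
have e0 : 0 <= ip e e by apply: Rintegral_ge0 => w _; rewrite -expr2 sqr_ge0.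
have eL : e \in L2 by apply: L2D; exact: L2Z.
move: e0; rewrite ipDl//; try exact: L2Z.
rewrite !ipZl// ![ip _ (fun _ => _ + _)]ipC !ipDl//; try exact: L2Z.
rewrite !ipZl// (ipC (p N) (Y N)); lra.
Qed.
End martingale.
End square_integrable.

(** * The information carried by a subfamily *)

Section generated_information.
Context (dT dU : measure_display) (T : measurableType dT)
  (U : measurableType dU) (R : realType) (P : probability T R)
  (I : finType) (X : I -> {RV P >-> U}).

(** This class is closed under intersection, mutual independence applies to it
    directly, and it generates the sigma-algebra of the [X i], [i] in [J]. *)
Definition boxes (J : {set I}) : set (set T) :=
  [set E | exists2 A : I -> set U, (forall i, measurable (A i)) &
    E = \bigcap_(i in [set` J]) (X i @^-1` A i)].

(** The sample space with the sigma-algebra of the [X i], [i] in [J]: a function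
    on [T] is measurable on [info J] when it only depends on these variables. *)
Definition info (J : {set I}) := g_sigma_algebraType (boxes J).

Let mX i A : measurable A -> measurable (X i @^-1` A).
Proof. by move=> mA; rewrite -[_ @^-1` _]setTI; exact: measurable_funPT. Qed.

Lemma boxes_measurable J : boxes J `<=` measurable.
Proof.
move=> _ [A mA ->]; apply: fin_bigcap_measurable => // i _; exact: mX.
Qed.

Lemma boxesI J : setI_closed (boxes J).
Proof.
move=> _ _ [A mA ->] [B mB ->]; exists (fun i => A i `&` B i).
  by move=> i; exact: measurableI.
by rewrite -bigcapI.
Qed.

Lemma boxesT J : boxes J setT.
Proof. by exists (fun=> setT) => //; apply/esym/seteqP; split. Qed.

Lemma measurable_coarsen J : measurable_fun setT (id : T -> info J).
Proof.
move=> _ B mB; rewrite setTI.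
exact: (smallest_sub (@sigma_algebra_measurable _ T) (@boxes_measurable J)).
Qed.

(** The identity, seen as a random variable that carries all the information of
    the [X i], [i] in [J]. *)
Definition coarsen J : {RV P >-> info J} :=
  mfun_Sub (mem_set (@measurable_coarsen J)).

Lemma measurable_info (J : {set I}) i : i \in J ->
  measurable_fun setT (X i : info J -> U).
Proof.
move=> iJ _ B mB; rewrite setTI; apply: sub_sigma_algebra.
exists (fun l => if l == i then B else setT).
  by move=> l; case: eqP.
apply/seteqP; split => [w XB l /= lJ|w /(_ i iJ)]; last by rewrite /= eqxx.
by case: eqP => // ->.
Qed.

Lemma independent_coarsen (J : {set I}) a :
  mutually_independent P X -> a \notin J ->
  independent_pair (coarsen J) (X a).
Proof.
move=> indX aJ; apply: (independent_pair_generator (X := coarsen J) (Z := X a)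
  (G := boxes J : set (set (info J)))) => //.
- exact: boxesI.
- exact: boxesT.
move=> _ B [A mA ->] mB.
pose A' l := if l == a then B else A l.
have mA' l : measurable (A' l) by rewrite /A'; case: eqP.
have EJ : \bigcap_(i in [set` J]) (X i @^-1` A i) =
    \bigcap_(i in [set` J]) (X i @^-1` A' i).
  apply: eq_bigcapr => l /= lJ; rewrite /A' ifN//.
  by apply: contraNneq aJ => <-.
have Ea : X a @^-1` B = X a @^-1` A' a by rewrite /A' eqxx.
rewrite -[coarsen J @^-1` _]/(\bigcap_(i in [set` J]) (X i @^-1` A i)) EJ Ea.
have -> : \bigcap_(i in [set` J]) (X i @^-1` A' i) `&` X a @^-1` A' a =
    \bigcap_(i in [set` a |: J]) (X i @^-1` A' i).
  apply/seteqP; split => w.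
    by move=> [wJ wa] l; rewrite /= in_setU1 => /predU1P[->//|]; exact: wJ.
  move=> wJ; split; last by apply: (wJ a); rewrite /= setU11.
  by move=> l lJ; apply: wJ; rewrite /= in_setU1 lJ orbT.
by rewrite !indX// big_setU1//= muleC.
Qed.

Hypothesis indX : mutually_independent P X.

(** Integrating over [X a] first, with everything indexed by [J] held fixed,
    replaces [g (X b, X a)] by its conditional expectation given [X b], which
    vanishes. *)
Lemma ip_degenerate (J : {set I}) a b (H : T -> R) (g : U * U -> R) :
  a \notin J -> b \in J ->
  measurable_fun setT g -> measurable_fun setT (H : info J -> R) ->
  H \in Lfun P 2%:E -> (fun w => g (X b w, X a w)) \in Lfun P 2%:E ->
  cond_expectation_ae_eq P (X b) (fun w => g (X b w, X a w)) (cst 0) ->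
  ip P H (fun w => g (X b w, X a w)) = 0.
Proof.
move=> aJ bJ mg mH HL gL [Z [gi Zi _ ZE] Z0].
rewrite /ip /Rintegral.
have := @integral_degenerate _ _ _ _ _ _ _ _ _ _ (coarsen J) (X a)
  (X b : info J -> U) g H (independent_coarsen indX aJ) (measurable_info bJ)
  mg mH gi (ip_integrable HL gL).
move=> -> // B mB; rewrite ZE; last by exists B => //; rewrite setTI.
have mXB := mX b mB.
rewrite (ae_eq_integral (cst 0%E))//; first by rewrite integral0.
  exact/measurable_funTS/(measurable_int _ Zi).
by apply: filterS Z0 => w /= -> _.
Qed.

End generated_information.

(** * One coordinate of a degenerate array *)

Section coordinate.
Context (dT dU : measure_display) (T : measurableType dT)
  (U : measurableType dU) (R : realType) (P : probability T R) (n : nat)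
  (X : 'I_n.+1 -> {RV P >-> U}) (g : 'I_n.+1 -> 'I_n.+1 -> U * U -> R) (K : R).
Local Notation L2 := (Lfun P 2%:E).

Let u i j w := g i j (X i w, X j w).

Hypotheses (indX : mutually_independent P X)
  (mg : forall i j : 'I_n.+1, (i < j)%N -> measurable_fun setT (g i j))
  (K0 : 0 <= K)
  (uL : forall i j : 'I_n.+1, (i < j)%N -> u i j \in L2)
  (uK : forall i j : 'I_n.+1, (i < j)%N -> ip P (u i j) (u i j) <= K)
  (u0 : forall i j : 'I_n.+1, (i < j)%N ->
    cond_expectation_ae_eq P (X i) (u i j) (cst 0) /\
    cond_expectation_ae_eq P (X j) (u i j) (cst 0)).

(** The kernel [g i j] is degenerate in both arguments, so it does not matter
    which of [i] and [j] the factor [H] sees. *)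
Let ip_u0 (i j : 'I_n.+1) (J : {set 'I_n.+1}) (H : T -> R) : (i < j)%N ->
  (i \in J) != (j \in J) ->
  measurable_fun setT (H : info X J -> R) -> H \in L2 -> ip P H (u i j) = 0.
Proof.
move=> ij; have [ui uj] := u0 ij.
have [iJ|iJ] := boolP (i \in J); have [jJ|jJ] := boolP (j \in J) => // _ mH HL.
  exact: (ip_degenerate indX jJ iJ (mg ij) mH HL (uL ij) ui).
apply: (ip_degenerate indX iJ jJ (g := g i j \o (fun z => (z.2, z.1)))
  _ mH HL) => //.
- apply: measurableT_comp; first exact: mg.
  exact: measurable_fun_pair.
- exact: uL.
Qed.

Let measurable_u (i j : 'I_n.+1) (J : {set 'I_n.+1}) : (i < j)%N ->
  i \in J -> j \in J -> measurable_fun setT (u i j : info X J -> R).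
Proof.
move=> ij iJ jJ; apply: measurableT_comp; first exact: mg.
by apply: measurable_fun_pair; exact: measurable_info.
Qed.

Let row (j : 'I_n.+1) w := \sum_(i < n.+1 | (i < j)%N) u i j w.

(** With the weight inside the increments, a normalized sum of the rows is the
    difference of the martingale [Y] and one of its Cesaro means. *)
Let D k w := k%:R^-1 * row (inord k) w.

Let Y k w := \sum_(j < k) D j w.

Let rowL j : row j \in L2.
Proof. by apply: L2_sum => i ij; apply: uL. Qed.

Let DL k : D k \in L2.
Proof. exact: L2Z. Qed.

(** Two entries [u i j] and [u l j] of a row are orthogonal because [u i j] does
    not depend on [X l]. *)
Let ip_row j : ip P (row j) (row j) <= j%:R * K.
Proof.
rewrite ip_suml//; last by move=> i; exact: uL.
apply: (@le_trans _ _ (\sum_(i < n.+1 | (i < j)%N) K)); last first.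
  rewrite -(big_ord_widen _ (fun=> K)) ?sumr_const ?card_ord ?mulr_natl//.
  exact/ltnW/ltn_ord.
apply: ler_sum => i ij; rewrite ipC ip_suml//; last 2 first.
- by move=> l; exact: uL.
- exact: uL.
rewrite (bigD1 i)//= big1 ?addr0; first exact: uK.
move=> l /andP[lj li]; rewrite ipC.
have jl : j != l by apply: contraTneq lj => <-; rewrite ltnn.
apply: (@ip_u0 _ _ [set~ l]); rewrite ?uL//.
  by rewrite !inE eqxx (negbTE jl).
by apply: measurable_u; rewrite // !inE// eq_sym.
Qed.

Let ip_D k : (k < n.+1)%N -> ip P (D k) (D k) <= k%:R^-1 * K.
Proof.
move=> kn; rewrite ipZl// ipC ipZl//.
have := ip_row (inord k); rewrite inordK//.
have [->|k0] := posnP k; first by rewrite invr0 !mul0r.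
move=> h; rewrite mulrA (le_trans (ler_wpM2l _ h)) ?mulr_ge0 ?invr_ge0//.
by rewrite mulrA mulfVK// pnatr_eq0 -lt0n.
Qed.

Let past k := [set l : 'I_n.+1 | (l < k)%N]%SET.

Let ip_D0 k (H : T -> R) : (k < n.+1)%N -> H \in L2 ->
  measurable_fun setT (H : info X (past k) -> R) -> ip P H (D k) = 0.
Proof.
move=> kn HL mH; rewrite ipC ipZl// ip_suml//; last by move=> i; exact: uL.
rewrite big1 ?mulr0// => i ik; rewrite ipC.
apply: (@ip_u0 _ _ (past k)) => //.
by move: ik; rewrite !inE inordK// => ->; rewrite ltnn.
Qed.

Let measurable_Y j k : (j <= k)%N -> (k <= n.+1)%N ->
  measurable_fun setT (Y j : info X (past k) -> R).
Proof.
move=> jk kn.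
apply: (@measurable_sum _ (info X (past k)) R setT _ _
  (fun l : 'I_j => D l)) => l.
have lk : (l < k)%N by exact: leq_trans (ltn_ord l) jk.
have lE : (inord l : 'I_n.+1) = l :> nat by rewrite inordK// (leq_trans lk).
apply: measurable_funM => //.
apply: (@measurable_sum_cond _ (info X (past k))) => i il.
by apply: measurable_u; rewrite // !inE ?lE// (ltn_trans il)// lE.
Qed.

Let YL k : Y k \in L2.
Proof. exact: L2_sum. Qed.

Let p w := runmax (Y ^~ w) n.+1.
Let q w := runmax (fun j => - Y j w) n.+1.

Let YY : ip P (Y n.+1) (Y n.+1) <= K * (2 * ln n.+1%:R).
Proof.
rewrite partial_sum_sqr//; last first.
  by move=> k kn; exact: ip_D0 (measurable_Y (leqnn k) (ltnW kn)).
apply: (@le_trans _ _ (\sum_(k < n.+1) k%:R^-1 * K)).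
  by apply: ler_sum => k _; exact: ip_D.
by rewrite -mulr_suml mulrC ler_wpM2l ?harmonic_le_ln.
Qed.

Let pp : ip P p p <= 4 * ip P (Y n.+1) (Y n.+1).
Proof.
apply: doob_sqr_le => // k kn; apply: ip_D0 => //.
  by apply: L2_runmax => j _; exact: YL.
apply: (@measurable_runmax _ (info X (past k))) => j jk.
exact: measurable_Y jk (ltnW kn).
Qed.

Let NYE k : (fun w => - Y k w) = (fun w => \sum_(j < k) (-1 * D j w)).
Proof. by apply/funext => w; rewrite -mulr_sumr mulN1r. Qed.

Let qq : ip P q q <= 4 * ip P (Y n.+1) (Y n.+1).
Proof.
have qE k : (fun w => runmax (fun j => - Y j w) k) =
    (fun w => runmax (fun j => \sum_(i < j) (-1 * D i w)) k).
  apply/funext => w; congr runmax; apply/funext => j.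
  by rewrite -mulr_sumr mulN1r.
rewrite /q qE.
have -> : ip P (Y n.+1) (Y n.+1) = ip P (fun w => \sum_(j < n.+1) (-1 * D j w))
     (fun w => \sum_(j < n.+1) (-1 * D j w)).
  by rewrite -NYE; apply: eq_Rintegral => w _; rewrite mulrNN.
have NDL k : (fun w => -1 * D k w) \in L2 by exact: L2Z.
apply: (@doob_sqr_le _ _ _ P (fun k w => -1 * D k w)) => // k kn.
have rL : (fun w => runmax (fun j => \sum_(i < j) (-1 * D i w)) k) \in L2.
  apply: (@L2_runmax _ _ _ _ (fun j w => \sum_(i < j) (-1 * D i w))) => j _.
  exact: L2_sum.
rewrite ipC ipZl// ipC ip_D0 ?mulr0//.
rewrite -qE; apply: (@measurable_runmax _ (info X (past k))) => j jk.
by apply: measurableT_comp => //; exact: measurable_Y jk (ltnW kn).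
Qed.

(** The bound [S] does not depend on [k], so that the coordinates can be added
    before the maximum over [k] is taken. *)
Lemma normalized_max_sqr : exists S : T -> R, [/\
  measurable_fun setT S,
  forall w k, (k < n.+1)%N ->
    (\sum_(i < n.+1) \sum_(j < n.+1 | (i < j < k.+1)%N) u i j w) ^+ 2
      / k%:R ^+ 2
      <= S w &
  (\int[P]_w (S w)%:E <= (64 * K * ln n.+1%:R)%:E)%E].
Proof.
have pL : p \in L2 by apply: L2_runmax => j _; exact: YL.
have qL : q \in L2.
  apply: (@L2_runmax _ _ _ _ (fun j w => - Y j w)) => j _.
  by rewrite NYE; apply: L2_sum => i _; exact: L2Z.
have iS : P.-integrable setT (EFin \o (fun w => p w * p w + q w * q w)).
  exact: (integrableD measurableT (ip_integrable pL pL) (ip_integrable qL qL)).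
exists (fun w => 4 * (p w ^+ 2 + q w ^+ 2)); split.
- apply: measurable_funM => //; apply: measurable_funD; apply: measurable_funX.
    exact: L2_measurable pL.
  exact: L2_measurable qL.
- move=> w k kn.
  have -> : \sum_(i < n.+1) \sum_(j < n.+1 | (i < j < k.+1)%N) u i j w =
      \sum_(j < k.+1) row (inord j) w.
    rewrite (exchange_big_dep (fun j : 'I_n.+1 => (j < k.+1)%N))/=; last first.
      by move=> i j _ /andP[].
    rewrite (big_ord_widen _ (fun j => row (inord j) w) kn).
    apply: eq_bigr => j jk; rewrite inord_val.
    by apply: eq_bigl => i; rewrite jk andbT.
  apply: (@normalized_sum_le_runmax _ (fun j => row (inord j) w)) => //.
  by rewrite /row big1// => i; rewrite inordK.
- have -> : (\int[P]_w (4 * (p w ^+ 2 + q w ^+ 2))%:E =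
      (4 * (ip P p p + ip P q q))%:E)%E.
    have -> : ip P p p + ip P q q = \int[P]_w (p w * p w + q w * q w).
      by rewrite RintegralD//; exact: ip_integrable.
    rewrite EFinM fineK; last exact: integrable_fin_num.
    by rewrite -integralZl//; apply: eq_integral => w _; rewrite EFinM !expr2.
  rewrite lee_fin.
  have := YY; have := pp; have := qq; lra.
Qed.

End coordinate.

(** * Second moments of the array *)

Section array_D2.
Context (dT : measure_display) (T : measurableType dT) (R : realType)
  (P : probability T R) (n p d : nat)
  (X : 'I_n -> {RV P >-> p.-tuple R})
  (f : 'I_n -> 'I_n -> p.-tuple R * p.-tuple R -> d.-tuple R).
Hypotheses
  (mf : forall i j : 'I_n, (i < j)%N -> measurable_fun [set: _] (f i j))
  (D2_fin : (D2 P X f < +oo)%E).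

Lemma D2_ge0 : (0 <= D2 P X f)%E.
Proof. exact: bigmax_ge_id. Qed.

Lemma expectation_sqr_le_D2 (i j : 'I_n) (m : 'I_d) : (i < j)%N ->
  ('E_P[fun w => (`|tnth (fX P X f i j w) m| ^+ 2)%R] `^ 2^-1 <= D2 P X f)%E.
Proof.
move=> ij; apply: le_trans (le_bigmax_cond _ _ (isT : xpredT i)).
apply: le_trans (le_bigmax_cond _ _ ij).
exact: (le_trans _ (le_bigmax_cond _ _ (isT : xpredT m))).
Qed.

Lemma measurable_kernel (i j : 'I_n) (m : 'I_d) : (i < j)%N ->
  measurable_fun setT (fun z => tnth (f i j z) m).
Proof.
by move=> ij; apply: (measurableT_comp (measurable_tnth m)); exact: mf.
Qed.

Lemma kernel_L2 (i j : 'I_n) (m : 'I_d) : (i < j)%N ->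
  (fun w => tnth (f i j (X i w, X j w)) m) \in Lfun P 2%:E.
Proof.
move=> ij; rewrite inE; apply/andP; split; rewrite inE/=.
  apply: (measurableT_comp (measurable_kernel m ij)).
  exact: measurable_fun_pair.
rewrite /finite_norm; apply: le_lt_trans D2_fin.
apply: le_trans (expectation_sqr_le_D2 m ij).
rewrite !unlock le_eqVlt; apply/orP; left; apply/eqP; congr (_ `^ _)%E.
by apply: eq_integral => w _; rewrite /= powR_mulrn.
Qed.

Lemma kernel_ip_le (i j : 'I_n) (m : 'I_d) : (i < j)%N ->
  ip P (fun w => tnth (f i j (X i w, X j w)) m)
    (fun w => tnth (f i j (X i w, X j w)) m) <= fine (D2 P X f) ^+ 2.
Proof.
move=> ij; set u := fun w => tnth _ _.
have uL : u \in Lfun P 2%:E by exact: kernel_L2.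
have ED : (\int[P]_w (u w * u w)%:E = (ip P u u)%:E)%E.
  by rewrite fineK//; exact/integrable_fin_num/ip_integrable.
have ip0 : 0 <= ip P u u by apply: Rintegral_ge0 => w _; rewrite -expr2 sqr_ge0.
have := expectation_sqr_le_D2 m ij.
rewrite unlock (_ : integral _ _ _ = (ip P u u)%:E); last first.
  rewrite -ED; apply: eq_integral => w _.
  by rewrite real_normK ?num_real// expr2.
rewrite poweR_EFin powR12_sqrt//.
rewrite -[D2 P X f]fineK ?ge0_fin_numE ?D2_ge0//= lee_fin => h.
by rewrite -(sqr_sqrtr ip0) ler_sqr ?nnegrE// fine_ge0// D2_ge0.
Qed.
End array_D2.

(** * The maximal inequality *)

(** The integral of a nonnegative function is a supremum over the simple
    functions below it, so it is monotone on arbitrary functions. *)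
Lemma ge0_integral_le d (T : measurableType d) (R : realType)
    (mu : {measure set T -> \bar R}) (f1 f2 : T -> \bar R) :
  (forall w, 0 <= f1 w)%E -> (forall w, f1 w <= f2 w)%E ->
  (\int[mu]_w f1 w <= \int[mu]_w f2 w)%E.
Proof.
move=> f10 f12; have f20 w : (0 <= f2 w)%E by exact: le_trans (f12 w).
rewrite !ge0_integralTE//; apply: le_ereal_sup => _ [h hf1 <-].
by exists h => // w; exact: le_trans (hf1 w) (f12 w).
Qed.

Theorem lemma2p1 (R : realType) :
  exists C : R, 0 < C /\
  forall (n p d : nat) (dT : measure_display) (T : measurableType dT)
    (P : probability T R)
    (X : 'I_n -> {RV P >-> p.-tuple R})
    (f : 'I_n -> 'I_n -> p.-tuple R * p.-tuple R -> d.-tuple R),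
    (2 <= n)%N ->
    mutually_independent P X ->
    (forall i j : 'I_n, (i < j)%N -> measurable_fun [set: _] (f i j)) ->
    (forall i j : 'I_n, (i < j)%N -> forall x y, f i j (x, y) = f i j (y, x)) ->
    completely_degenerate P X f ->
    (D2 P X f < +oo)%E ->
    ('E_P[fun w => (\big[Num.max/0]_(2 <= k < n.+1)
                      (enorm (M P X f k w) ^+ 2 / (k.-1)%:R ^+ 2))%R]
       <= C%:E * D2 P X f ^+ 2 * d%:R%:E * (ln n%:R)%:E)%E.
Proof.
exists 64; split => // -[//|n] p d dT T P X f _ indX mf _ degX D2_fin.
set K := fine (D2 P X f) ^+ 2.
have /choice[S SP] (m : 'I_d) := normalized_max_sqr (K := K)
  (g := fun i j z => tnth (f i j z) m) indX
  (fun i j => @measurable_kernel _ _ _ _ _ mf i j m)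
  (sqr_ge0 _) (fun i j => @kernel_L2 _ _ _ _ _ _ _ _ _ mf D2_fin i j m)
  (fun i j => @kernel_ip_le _ _ _ _ _ _ _ _ _ mf D2_fin i j m)
  (fun i j => degX i j m).
have S0 m w : 0 <= S m w.
  (* At [k = 0] the dominated quantity is [0 / 0 ^+ 2 = 0]. *)
  have [_ /(_ w 0%N isT) + _] := SP m.
  by rewrite expr0n/= invr0 mulr0.
rewrite unlock.
apply: (@le_trans _ _ (\int[P]_w \sum_(m < d) (S m w)%:E)%E).
  apply: ge0_integral_le => w.
    by rewrite lee_fin; apply: bigmax_ge_id.
  rewrite sumEFin lee_fin big_nat; apply: bigmax_le; first exact: sumr_ge0.
  move=> [|[|k]]//; rewrite ltnS => /andP[_ kn].
  rewrite /enorm sqr_sqrtr; last by apply: sumr_ge0 => m _; exact: sqr_ge0.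
  rewrite mulr_suml; apply: ler_sum => m _.
  have [_ /(_ w k.+1 kn) + _] := SP m.
  by rewrite /M tnth_mktuple.
rewrite ge0_integral_sum//; last 2 first.
- by move=> m; have [mS _ _] := SP m; exact/measurable_EFinP.
- by move=> m w _; rewrite lee_fin.
apply: (@le_trans _ _ (\sum_(m < d) (64 * K * ln n.+1%:R)%:E)%E).
  by apply: lee_sum => m _; have [] := SP m.
rewrite sumEFin sumr_const card_ord -[D2 P X f]fineK ?ge0_fin_numE ?D2_ge0//.
by rewrite -!EFin_expe -!EFinM lee_fin -/K -[leLHS]mulr_natr [leLHS]mulrAC.
Qed.
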